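(* Let $\overline{f}\in L^1(\mathbb{R}^2\times\mathbb{R}^2)$ be a radial steady state of the two-dimensional gravitational Vlasov-Poisson system of the type described in the context. Then for any $K>0$ and any nonnegative $h_0\in L^\infty(\mathbb{R}^2\times \mathbb{R}^2)$, the initial density $$g_0=\overline{f}\,\mathbf{1}_{ \{\overline{f}\leq K\}}\,h_0$$ has the following properties: $g_0$ is nonnegative, $g_0\in L^1\cap L^\infty(\mathbb{R}^2\times\mathbb{R}^2)$, $\iint |v|^m g_0(x,v)\,dx\,dv<+\infty$ for some $m>2$, and there is a constant $C_0$ such that $$\forall k\geq 1,\quad \iint_{\mathbb{R}^2\times \mathbb{R}^2} |v|^k g_0(x,v)\,dx\,dv\leq (C_0 k)^{\frac{k}{2}}.$$
   Context: The two-dimensional gravitational Vlasov-Poisson system is $$\partial_t f+v\cdot \nabla_x f-\nabla U\cdot \nabla_v f=0,\qquad U(t,x)=\int_{\mathbb{R}^2}\ln|x-y|\,\rho(t,y)\,dy,\qquad \rho(t,x)=\int_{\mathbb{R}^2} f(t,x,v)\,dv.$$ The steady states considered (whose existence is due to Dolbeault, Fernández and Sánchez) are the nonnegative functions $\overline{f}\in L^1(\mathbb{R}^2\times\mathbb{R}^2)$ of the form $$\overline{f}(x,v)=\varphi\left(\frac{|v|^2}{2}+U(x)\right),\qquad U(x)=\int_{\mathbb{R}^2}\ln|x-y|\,\overline{\rho}(y)\,dy,\qquad \overline{\rho}(x)=\int_{\mathbb{R}^2}\overline{f}(x,v)\,dv,$$ where $\varphi:\mathbb{R}\to[0,\infty)$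 is continuous, nonincreasing and satisfies $\mathrm{supp}(\varphi)\subset\,]-\infty,M]$ for some $M\in\mathbb{R}$ ($\varphi$ may be unbounded at $-\infty$, so $\overline f$ need not belong to $L^\infty$); $\overline{\rho}$ is radially symmetric and compactly supported in $B(0,1)$; and $U$ is of class $C^1$ on $\mathbb{R}^2\setminus\{0\}$. For such states, for all $x\neq 0$, $$U(x)=\ln |x|\left(\int_{\mathbb{R}^2} \overline{\rho}(y)\,dy\right)+\int_{|y|>|x|}\ln\left(\frac{|y|}{|x|}\right)\overline{\rho}(y)\,dy.$$ $\mathbf{1}_{\{\overline f\le K\}}$ is the indicator function of the set $\{(x,v):\overline f(x,v)\le K\}$. *)

(* Defs.v *)
From HB Require Import structures.
From mathcomp Require Import all_boot all_order all_algebra.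
From mathcomp Require Import all_classical all_reals all_analysis.

Set Implicit Arguments.
Unset Strict Implicit.
Unset Printing Implicit Defensive.
Import Order.TTheory GRing.Theory Num.Theory.
Import numFieldNormedType.Exports.

Local Open Scope classical_set_scope.
Local Open Scope ring_scope.

(* The library's own instance of this fact is shadowed by the one for products
   of subprobabilities. *)
Lemma sigma_finite_product d1 d2 (T1 : measurableType d1)
    (T2 : measurableType d2) (R : realType)
    (m1 : {sigma_finite_measure set T1 -> \bar R})
    (m2 : {sigma_finite_measure set T2 -> \bar R}) :
  sigma_finite setT (m1 \x m2)%E.
Proof.
have /sigma_finiteP[F [TF ndF Foo]] := sigma_finiteT m1.
have /sigma_finiteP[G [TG ndG Goo]] := sigma_finiteT m2.
exists (fun n => F n `*` G n).
  rewrite -setXTT TF TG predeqE => -[x y]; split.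
    move=> [/= [n _ Fnx] [k _ Gky]]; exists (maxn n k) => //; split.
    - by move: x Fnx; exact/subsetPset/ndF/leq_maxl.
    - by move: y Gky; exact/subsetPset/ndG/leq_maxr.
  by move=> [n _ []/= ? ?]; split; exists n.
move=> k; have [? ?] := Foo k; have [? ?] := Goo k.
split; first exact: measurableX.
by rewrite product_measure1E// lte_mul_pinfty// ge0_fin_numE.
Qed.

Section VlasovPoisson2D.
Context {R : realType}.

(* The library norm on [R * R] is the sup norm; it induces the same topology. *)
Definition enorm (x : R * R) : R := Num.sqrt (x.1 ^+ 2 + x.2 ^+ 2).

Let T := measurableTypeR R.

Definition leb2 : set (T * T) -> \bar R :=
  @product_measure1 _ _ T T R lebesgue_measure lebesgue_measure.

HB.instance Definition _ := Measure.on leb2.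

Lemma leb2_sigma_finite : sigma_finite setT leb2.
Proof. exact: sigma_finite_product. Qed.

HB.instance Definition _ :=
  Measure_isSigmaFinite.Build _ _ _ leb2 leb2_sigma_finite.

(* Points of phase space are pairs [(x, v)]. *)
Definition leb4 : set ((T * T) * (T * T)) -> \bar R := (leb2 \x leb2)%E.

HB.instance Definition _ := Measure.on leb4.

Lemma leb4_sigma_finite : sigma_finite setT leb4.
Proof. exact: sigma_finite_product. Qed.

HB.instance Definition _ :=
  Measure_isSigmaFinite.Build _ _ _ leb4 leb4_sigma_finite.

(* Extended-real valued, since it may be infinite at [x = 0]. *)
Definition density (f : (R * R) * (R * R) -> R) (x : R * R) : \bar R :=
  (\int[leb2]_v (f (x, v))%:E)%E.

(* The library's convention [ln 0 = 0] only affects the null set [y = x].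
   When the integrand is measurable, a finite value of the integral entails
   that the integrand is integrable. *)
Definition log_potential (rho : R * R -> \bar R) (x : R * R) : \bar R :=
  (\int[leb2]_y ((ln (enorm (x - y)))%:E * rho y))%E.

Definition C1_on (D : set (R * R)) (U : R * R -> R) : Prop :=
  forall x, D x ->
    differentiable U x /\
    forall w : R * R, {for x, continuous (fun z => 'd U z w)}.

(* Densities are defined up to null sets, so relations between them are
   required almost everywhere; the potential [U] is a genuine function on the
   punctured plane (its value at [0] is irrelevant). *)
Record steady_state_with (phi : R -> R) (M : R) (U : R * R -> R)
    (f : (R * R) * (R * R) -> R) : Prop := SteadyStateWith {
  ss_phi_ge0 : forall s, 0 <= phi s;
  ss_phi_continuous : continuous phi;
  ss_phi_nonincreasing : {homo phi : s t / s <= t >-> t <= s};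
  ss_phi_supp : closure [set s | phi s != 0] `<=` [set s | s <= M];
  ss_L1 : f \in Lfun leb4 1;
  ss_ge0 : {ae leb4, forall z, 0 <= f z};
  ss_form : {ae leb4, forall z, f z = phi (enorm z.2 ^+ 2 / 2 + U z.1)};
  ss_potential : forall x, x != 0 -> (U x)%:E = log_potential (density f) x;
  ss_radial : exists r : R -> \bar R,
    {ae leb2, forall x, density f x = r (enorm x)};
  ss_compact_supp : exists A : set (R * R),
    [/\ compact A, A `<=` [set x | enorm x < 1] &
        {ae leb2, forall x, ~ A x -> density f x = 0%E}];
  ss_C1 : C1_on [set x | x != 0] U
}.

Definition radial_steady_state (f : (R * R) * (R * R) -> R) : Prop :=
  exists phi M U, steady_state_with phi M U f.

End VlasovPoisson2D.

(* Main.v *)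
Require Import Defs.
From HB Require Import structures.
From mathcomp Require Import all_boot all_order all_algebra.
From mathcomp Require Import all_classical all_reals all_analysis.
From mathcomp Require Import measurable_realfun ess_sup_inf.
From mathcomp Require Import ring lra.

Set Implicit Arguments.
Unset Strict Implicit.
Unset Printing Implicit Defensive.
Import Order.TTheory GRing.Theory Num.Theory.
Import numFieldNormedType.Exports.

Local Open Scope classical_set_scope.
Local Open Scope ring_scope.

(** Put [m := \iint f].  On the support of a steady state one has
    [|v|^2/2 + U(x) <= M], so the whole statement rests on a lower bound for
    the potential: [U(x) >= m * ln |x| - const] for [0 < |x| <= 1].  Given that
    bound, [|v|^2 <= 2 A - 2 m ln |x|] on the support, and for a large constant
    [a] the function [exp(|v|^2 / a)] is there at most a constant times
    [|x|^-1 exp(-|v|^2 / a)], which is integrable over the unit disc times the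
    velocity plane ([expR_velocity_le_envelope], [integral_envelope_lty]).
    Since [g0] is bounded and vanishes off the support of [f], it has a finite
    exponential moment [\iint exp(|v|^2 / a) g0], and the elementary inequality
    [w^k <= (a k / 2)^(k/2) exp(w^2 / a)] turns this into the bound
    [(C0 k)^(k/2)] for every moment of order [k >= 1]
    ([exponential_moment_bounds]).  Integrability of [g0] and the moment of
    order 3 are by-products.

    The bound on [U] replaces Newton's formula for the logarithmic potential of
    a radial density, and is obtained without polar coordinates.  It is enough
    to bound from above the convolution [W] of the density with the nonnegative
    kernel [max(0, - ln |z|)].  A rotation is a product of three shears, each of
    which preserves the Lebesgue measure of the plane by Tonelli's theorem and
    translation invariance ([ge0_integral_rotate]); hence [W] is radial, and
    [W(r, 0)] is the average of [W] over the points
    [(r sqrt(1 - s^2), r s)], [0 <= s <= 1], of a circle.  After exchanging the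
    two integrals, what remains is the integral over [s] of
    [max(0, - ln |r s - y2|)], a one-dimensional quantity bounded by
    [- ln r + const] uniformly in [y] when [0 < r <= 1]
    ([integral_log_kernel_arc], [log_convolution_le]). *)

(** * The Lebesgue measure of the line and an integrable singularity *)

Section Line.
Context {R : realType}.
Local Notation mu := (@lebesgue_measure R).

Definition translation (a : R) : measurableTypeR R -> measurableTypeR R :=
  fun x => x + a.

Lemma measurable_translation a : measurable_fun setT (translation a).
Proof. exact: measurable_funD. Qed.

HB.instance Definition _ a := isMeasurableFun.Build _ _ _ _ (translation a)
  (measurable_translation a).

Lemma lebesgue_measure_translation (a : R) (A : set (measurableTypeR R)) :
  measurable A -> pushforward mu (translation a) A = mu A.
Proof.
move=> mA; apply/esym/lebesgue_measure_unique => //= _ [[b c]] _ <-.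
rewrite /pushforward.
rewrite (_ : _ @^-1` _ = `]b - a, c - a]%classic).
  rewrite !lebesgue_measure_itv/= !lte_fin ltrD2r.
  by case: ifP => // _; rewrite -!EFinD; congr EFin; ring.
by apply/seteqP; split => x /=; rewrite !in_itv/= ltrBlDr lerBrDr.
Qed.

Lemma ge0_integral_translation (f : R -> \bar R) (a : R) :
  measurable_fun setT f -> (forall x, (0 <= f x)%E) ->
  (\int[mu]_x f (x + a)%R = \int[mu]_x f x)%E.
Proof.
move=> mf f0.
transitivity (\int[pushforward mu (translation a)]_x f x)%E.
  rewrite ge0_integral_pushforward//; exact: measurable_translation.
apply: eq_measure_integral => //= A mA _.
exact: lebesgue_measure_translation.
Qed.

Lemma ge0_integral_reflection (f : R -> \bar R) :
  measurable_fun setT f -> (forall x, (0 <= f x)%E) ->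
  (\int[mu]_x f (- x)%R = \int[mu]_x f x)%E.
Proof.
move=> mf f0.
transitivity (\int[pushforward mu (-%R : _ -> measurableTypeR R)]_x f x)%E.
  by rewrite ge0_integral_pushforward.
apply: eq_measure_integral => //= A mA _.
exact: lebesgue_measureN.
Qed.

(** One integrable majorant serves twice: [2 * invsqrt1] dominates the
    logarithmic kernel of the line, and [invsqrt1 x.1 * invsqrt1 x.2]
    dominates [|x|^-1] in the unit disc of the plane. *)
Definition invsqrt1 (u : R) : R :=
  if `|u| <= 1 then `|u| `^ (- 2^-1) else 0.

Lemma invsqrt1_ge0 u : 0 <= invsqrt1 u.
Proof. by rewrite /invsqrt1; case: ifP => // _; exact: powR_ge0. Qed.

Lemma measurable_invsqrt1 : measurable_fun setT invsqrt1.
Proof.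
apply: measurable_fun_ifT => //.
  by apply: measurable_fun_ler => //; exact: measurable_normr.
by apply: (measurableT_comp (@measurable_powR _ _)).
Qed.

(** This is [ln t <= t] for [t = |u|^(-1/2)]. *)
Lemma ln_inv_le_invsqrt1 (u : R) : u != 0 ->
  Num.max 0 (- ln `|u|) <= 2 * invsqrt1 u.
Proof.
move=> u0; have a0 : 0 < `|u| by rewrite normr_gt0.
rewrite ge_max mulr_ge0 ?invsqrt1_ge0//= /invsqrt1; case: ifPn => [u1|].
  have -> : - ln `|u| = 2 * ln (`|u| `^ (- 2^-1)) by rewrite ln_powR; field.
  by rewrite ler_pM2l// ltW// ln_sublinear// powR_gt0.
by rewrite -ltNge => u1; rewrite mulr0 oppr_le0 ln_ge0// ltW.
Qed.

Lemma integral_invsqrt1_away0 (e : R) : 0 < e < 1 ->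
  (\int[mu]_(x in `[e, 1%R]) (invsqrt1 x)%:E <= 2%:E)%E.
Proof.
move=> /andP[e0 e1].
have dF (x : R) : 0 < x ->
    is_derive x 1 (fun y => 2 * y `^ (2^-1)) (x `^ (- 2^-1)).
  move=> x0; have h := @is_derive1_powR _ (2^-1) x x0.
  have := is_deriveZ 2 h; rewrite /GRing.scale/= => {}h.
  by apply: is_derive_eq h _; rewrite mulrA mulfV// mul1r; congr powR; field.
have -> : (\int[mu]_(x in `[e, 1%R]) (invsqrt1 x)%:E =
    \int[mu]_(x in `[e, 1%R]) (x `^ (- 2^-1))%:E)%E.
  apply: eq_integral => x; rewrite inE/= in_itv/= => /andP[ex x1].
  by rewrite /invsqrt1 ger0_norm ?x1// (le_trans _ ex)// ltW.
have cp (p x : R) : 0 < x -> {for x, continuous (fun y => y `^ p)}.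
  move=> x0; apply: differentiable_continuous; apply/derivable1_diffP.
  by apply: derivable_powR; rewrite in_itv/= x0.
rewrite (@continuous_FTC2 _ _ (fun y => 2 * y `^ (2^-1)))//.
- rewrite -EFinB lee_fin powR1 mulr1 gerBl mulr_ge0// powR_ge0//.
- apply: continuous_in_subspaceT => x; rewrite inE/= in_itv/= => /andP[ex _].
  by apply: cp; exact: lt_le_trans ex.
- split.
  + move=> x; rewrite in_itv/= => /andP[ex _].
    by have [] := dF x (lt_trans e0 ex).
  + apply: cvg_at_right_filter; apply: cvgM; first exact: cvg_cst.
    exact: cp.
  + apply: cvg_at_left_filter; apply: cvgM; first exact: cvg_cst.
    exact: cp.
- move=> x; rewrite in_itv/= => /andP[ex _].
  by rewrite derive1E; have [] := dF x (lt_trans e0 ex).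
Qed.

(** The bound away from 0 is uniform, so monotone convergence along the
    intervals [[1/(n+2), 1]] reaches the singularity. *)
Lemma integral_invsqrt1_half :
  (\int[mu]_(x in `]0%R, 1%R]) (invsqrt1 x)%:E <= 2%:E)%E.
Proof.
have mk : measurable_fun setT (EFin \o invsqrt1).
  by apply/measurable_EFinP; exact: measurable_invsqrt1.
pose F n : set R := `[n.+2%:R^-1, 1%R]%classic.
have -> : `]0%R, 1%R]%classic = \bigcup_n F n.
  apply/seteqP; split => x /=.
    rewrite in_itv/= => /andP[x0 x1].
    have [n /= ] := ltr_add_invr x0.
    rewrite add0r => nx; exists n => //=; rewrite /F/= in_itv/= x1 andbT.
    by rewrite (le_trans _ (ltW nx))// lef_pV2 ?posrE// ler_nat.
  case=> n _; rewrite /F/= !in_itv/= => /andP[nx ->].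
  by rewrite (lt_le_trans _ nx).
have cvF := @ge0_nondecreasing_set_cvg_integral _ (measurableTypeR R) _ F
  (EFin \o invsqrt1) mu.
apply: cvge_le (cvF _ _ _ _); last first.
- by move=> n x _; rewrite lee_fin invsqrt1_ge0.
- by move=> n; exact: measurable_funTS.
- by move=> n; exact: measurable_itv.
- apply/nondecreasing_seqP => n; rewrite subsetEset /F => x /=.
  rewrite !in_itv/= => /andP[nx ->]; rewrite andbT (le_trans _ nx)//.
  by rewrite lef_pV2 ?posrE// ler_nat.
- apply: nearW => n; apply: integral_invsqrt1_away0.
  by rewrite invr_gt0 ltr0n/= invf_lt1 ?ltr0n// ltr1n.
Qed.

Lemma integral_invsqrt1_lty : (\int[mu]_x (invsqrt1 x)%:E < +oo)%E.
Proof.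
pose K (x : R) := if 0 < x then invsqrt1 x else 0.
have K0 x : 0 <= K x by rewrite /K; case: ifP => // _; exact: invsqrt1_ge0.
have mK : measurable_fun setT (EFin \o K).
  apply/measurable_EFinP; apply: measurable_fun_ifT => //.
    exact: measurable_fun_ltr.
  exact: measurable_invsqrt1.
(* [invsqrt1 0 = 0], because a nonzero power of 0 is 0. *)
have -> : (\int[mu]_x (invsqrt1 x)%:E =
    \int[mu]_x ((EFin \o K) x + (EFin \o K) (- x)%R))%E.
  apply: eq_integral => x _ /=; rewrite /K /invsqrt1 normrN -EFinD oppr_gt0.
  have [x0|x0|->] := ltgtP x 0; rewrite ?add0r ?addr0//.
  by rewrite normr0 powR0 ?if_same// oppr_eq0 invr_eq0.
rewrite ge0_integralD//; last 3 first.
- by move=> x _ /=; rewrite lee_fin.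
- by move=> x _ /=; rewrite lee_fin.
- by apply: (measurableT_comp mK).
rewrite (ge0_integral_reflection mK)//.
suff h : (\int[mu]_x (EFin \o K) x <= 2%:E)%E.
  by rewrite lte_add_pinfty// (le_lt_trans h) ?ltry.
apply: le_trans integral_invsqrt1_half.
rewrite [leRHS]integral_mkcond le_eqVlt; apply/orP; left; apply/eqP.
apply: eq_integral => x _; rewrite patchE mem_setE in_itv/= /K /invsqrt1.
case: (ltP 0 x) => [x0|//]; rewrite gtr0_norm//=.
by case: ifP.
Qed.
End Line.

(** * Rotation invariance of the Lebesgue measure of the plane *)

Section Plane.
Context {R : realType}.
Local Notation mu := (@lebesgue_measure R).
Local Notation T := (measurableTypeR R).

Lemma leb2_tonelli1 (F : T * T -> \bar R) :
  measurable_fun setT F -> (forall y, (0 <= F y)%E) ->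
  (\int[leb2]_y F y = \int[mu]_a \int[mu]_b F (a, b))%E.
Proof. exact: fubini_tonelli1. Qed.

Lemma leb2_tonelli2 (F : T * T -> \bar R) :
  measurable_fun setT F -> (forall y, (0 <= F y)%E) ->
  (\int[leb2]_y F y = \int[mu]_b \int[mu]_a F (a, b))%E.
Proof. exact: fubini_tonelli2. Qed.

Definition shear1 (a : R) (y : T * T) : T * T := (y.1 + a * y.2, y.2).
Definition shear2 (a : R) (y : T * T) : T * T := (y.1, y.2 + a * y.1).
Definition rotate (c s : R) (y : T * T) : T * T :=
  (c * y.1 - s * y.2, s * y.1 + c * y.2).

Lemma measurable_shear1 a : measurable_fun setT (shear1 a).
Proof.
apply/measurable_fun_pair; last exact: measurable_snd.
apply: measurable_funD; first exact: measurable_fst.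
by apply: measurable_funM => //; exact: measurable_snd.
Qed.

Lemma measurable_shear2 a : measurable_fun setT (shear2 a).
Proof.
apply/measurable_fun_pair; first exact: measurable_fst.
apply: measurable_funD; first exact: measurable_snd.
by apply: measurable_funM => //; exact: measurable_fst.
Qed.

Lemma measurable_rotate c s : measurable_fun setT (rotate c s).
Proof.
apply/measurable_fun_pair.
  apply: measurable_funB; apply: measurable_funM => //.
apply: measurable_funD; apply: measurable_funM => //.
Qed.

(** On each horizontal line a shear is a translation. *)
Lemma ge0_integral_shear1 (F : T * T -> \bar R) a :
  measurable_fun setT F -> (forall y, (0 <= F y)%E) ->
  (\int[leb2]_y F (shear1 a y) = \int[leb2]_y F y)%E.
Proof.
move=> mF F0; rewrite !leb2_tonelli2//; last first.
  by apply: measurableT_comp mF _; exact: measurable_shear1.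
apply: eq_integral => b _ /=.
apply: (ge0_integral_translation (f := fun x => F (x, b)) (a * b)) => //.
apply: measurableT_comp mF _; exact: pair2_measurable.
Qed.

Lemma ge0_integral_shear2 (F : T * T -> \bar R) a :
  measurable_fun setT F -> (forall y, (0 <= F y)%E) ->
  (\int[leb2]_y F (shear2 a y) = \int[leb2]_y F y)%E.
Proof.
move=> mF F0; rewrite !leb2_tonelli1//; last first.
  by apply: measurableT_comp mF _; exact: measurable_shear2.
apply: eq_integral => b _ /=.
apply: (ge0_integral_translation (f := fun x => F (b, x)) (a * b)) => //.
apply: measurableT_comp mF _; exact: pair1_measurable.
Qed.

(** For the rotation of angle [t] the shear parameter is [- tan (t / 2)]. *)
Lemma rotate_shear c s : c ^+ 2 + s ^+ 2 = 1 -> s != 0 ->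
  rotate c s =
  shear1 ((c - 1) / s) \o shear2 s \o shear1 ((c - 1) / s).
Proof.
move=> cs s0; apply/funext => -[a b]; rewrite /rotate /shear1 /shear2 /=.
set k := (c - 1) / s.
have ks : 1 + k * s = c by rewrite divfK// addrC subrK.
have kc : k * (c + 1) = - s.
  have : (c - 1) * (c + 1) = - s ^+ 2.
    by transitivity (c ^+ 2 - 1); [ring|rewrite -cs; ring].
  by rewrite /k mulrAC => ->; field.
congr pair; last by rewrite -ks; ring.
have -> : c * a - s * b = c * a + k * (c + 1) * b by rewrite kc; ring.
by rewrite -ks; ring.
Qed.

Lemma ge0_integral_rotate (F : T * T -> \bar R) c s :
  c ^+ 2 + s ^+ 2 = 1 ->
  measurable_fun setT F -> (forall y, (0 <= F y)%E) ->
  (\int[leb2]_y F (rotate c s y) = \int[leb2]_y F y)%E.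
Proof.
have rot (d t : R) (G : T * T -> \bar R) : d ^+ 2 + t ^+ 2 = 1 -> t != 0 ->
    measurable_fun setT G -> (forall y, (0 <= G y)%E) ->
    (\int[leb2]_y G (rotate d t y) = \int[leb2]_y G y)%E.
  move=> dt t0 mG G0; rewrite (rotate_shear dt t0).
  have m1 : measurable_fun setT (G \o shear1 ((d - 1) / t)).
    by apply: measurableT_comp mG _; exact: measurable_shear1.
  have m2 := measurableT_comp m1 (measurable_shear2 t).
  rewrite -(ge0_integral_shear1 ((d - 1) / t) mG)//.
  rewrite -(ge0_integral_shear2 t m1); last by move=> y; exact: G0.
  by rewrite -(ge0_integral_shear1 ((d - 1) / t) m2)// => y; exact: G0.
move=> cs mF F0; have [s0|s0] := eqVneq s 0; last exact: rot.
(* The case [s = 0] is the identity or the half turn, and the latter is the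
   square of the quarter turn. *)
have i01 : 0 ^+ 2 + 1 ^+ 2 = 1 :> R by rewrite expr0n/= add0r expr1n.
have /orP[/eqP c1|/eqP c1] : (c == 1) || (c == -1).
  by rewrite -sqrf_eq1 -cs s0 expr0n addr0.
  apply: eq_integral => -[a b] _; congr F.
  by rewrite /rotate s0 c1 /=; congr pair; ring.
have o0 : 1 != 0 :> R := oner_neq0 R.
have mFr := measurableT_comp mF (measurable_rotate 0 1).
rewrite -(rot 0 1 F i01 o0 mF F0) -(rot 0 1 _ i01 o0 mFr); last first.
  by move=> y; exact: F0.
apply: eq_integral => -[a b] _; congr F.
by rewrite /rotate s0 c1 /=; congr pair; ring.
Qed.
End Plane.

(** * The truncated logarithmic kernel averaged over a circular arc *)

Section LogKernel.
Context {R : realType}.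
Local Notation mu := (@lebesgue_measure R).
Local Notation T := (measurableTypeR R).

Lemma measurable_enorm : measurable_fun setT (@enorm R : T * T -> R).
Proof.
apply: (measurableT_comp (continuous_measurable_fun (@sqrt_continuous R))).
by apply: measurable_funD; apply: measurable_funX;
  [exact: measurable_fst|exact: measurable_snd].
Qed.

Lemma enorm_ge0 (x : R * R) : 0 <= enorm x.
Proof. exact: sqrtr_ge0. Qed.

Lemma sqr_enorm (x : R * R) : enorm x ^+ 2 = x.1 ^+ 2 + x.2 ^+ 2.
Proof. by rewrite sqr_sqrtr// addr_ge0// sqr_ge0. Qed.

Lemma enorm_eq0 (x : R * R) : (enorm x == 0) = (x == 0).
Proof.
by rewrite -sqrf_eq0 sqr_enorm paddr_eq0 ?sqr_ge0// !sqrf_eq0; case: x.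
Qed.

Lemma enorm_ge_fst (x : R * R) : `|x.1| <= enorm x.
Proof.
by rewrite -(ler_pXn2r (n := 2)) ?nnegrE ?enorm_ge0// sqr_enorm real_normK
  ?num_real// lerDl sqr_ge0.
Qed.

Lemma enorm_ge_snd (x : R * R) : `|x.2| <= enorm x.
Proof.
by rewrite -(ler_pXn2r (n := 2)) ?nnegrE ?enorm_ge0// sqr_enorm real_normK
  ?num_real// lerDr sqr_ge0.
Qed.

Lemma enorm_rotate c s (x : T * T) : c ^+ 2 + s ^+ 2 = 1 ->
  enorm (rotate c s x) = enorm x.
Proof.
move=> cs; rewrite /enorm; congr Num.sqrt; rewrite /rotate/=.
by rewrite -[RHS]mul1r -cs; ring.
Qed.

Lemma rotateB c s (x y : T * T) :
  rotate c s (x - y) = rotate c s x - rotate c s y.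
Proof. by rewrite /rotate; congr pair => /=; ring. Qed.

Definition log_kernel (z : T * T) : R := Num.max 0 (- ln (enorm z)).

Lemma log_kernel_ge0 z : 0 <= log_kernel z.
Proof. by rewrite le_max lexx. Qed.

Lemma measurable_log_kernel : measurable_fun setT log_kernel.
Proof.
apply: measurable_maxr => //.
apply: measurableT_comp => //.
apply: measurableT_comp measurable_enorm; exact: measurable_ln.
Qed.

Lemma measurable_log_kernel_shift (x : T * T) :
  measurable_fun setT (fun y : T * T => log_kernel (x - y)).
Proof.
apply: (measurableT_comp measurable_log_kernel).
apply/measurable_fun_pair; apply: measurable_funB => //.
Qed.

Definition log_convolution (rho : T * T -> \bar R) (x : T * T) : \bar R :=
  (\int[leb2]_y ((log_kernel (x - y))%:E * rho y))%E.

(** The convention [ln 0 = 0] makes the kernel vanish at the origin, hence the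
    condition on the second coordinate. *)
Lemma log_kernel_snd (z : T * T) : z.2 != 0 ->
  log_kernel z <= Num.max 0 (- ln `|z.2|).
Proof.
move=> z2; rewrite /log_kernel ge_max le_max lexx/= le_max.
apply/orP; right; rewrite lerN2 ler_ln ?posrE ?normr_gt0 ?enorm_ge_snd//.
rewrite lt_neqAle enorm_ge0 eq_sym enorm_eq0 andbT.
by apply: contraNneq z2 => ->.
Qed.

(** Parametrizing the circle by its second coordinate avoids angles, and turns
    the average of the kernel over the arc into an integral over a line. *)
Definition quarter_arc (r s : R) : T * T := (r * Num.sqrt (1 - s ^+ 2), r * s).

(** The distance of two points is at least the distance of their second
    coordinates, here [r * |s - y.2 / r|]. *)
Lemma log_kernel_arc (r s : R) (y : T * T) : 0 < r <= 1 -> s != y.2 / r ->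
  log_kernel (quarter_arc r s - y) <= - ln r + 2 * invsqrt1 (s - y.2 / r).
Proof.
move=> /andP[r0 r1] sy.
have d0 : s - y.2 / r != 0 by rewrite subr_eq0.
have -> : quarter_arc r s - y =
    (r * Num.sqrt (1 - s ^+ 2) - y.1, r * (s - y.2 / r)) :> T * T.
  by congr pair; rewrite /=; field; rewrite gt_eqF.
apply: (le_trans (log_kernel_snd _)) => /=; first by rewrite mulf_neq0// gt_eqF.
have l0 : 0 <= - ln r by rewrite oppr_ge0 ln_le0.
have := ln_inv_le_invsqrt1 d0; rewrite ge_max => /andP[k0 kl].
rewrite ge_max addr_ge0//= normrM gtr0_norm// lnM ?posrE ?normr_gt0//.
by rewrite opprD lerD2l.
Qed.

Lemma measurable_quarter_arc r : measurable_fun setT (quarter_arc r).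
Proof.
apply/measurable_fun_pair; apply: measurable_funM => //.
apply: (measurableT_comp (continuous_measurable_fun (@sqrt_continuous R))).
by apply: measurable_funB => //; exact: measurable_funX.
Qed.

(** The point is the uniformity in [y]: the pole of the kernel may lie on the
    arc, but it is integrable, and translating it does not change the
    integral. *)
Lemma integral_log_kernel_arc (r : R) (y : T * T) : 0 < r <= 1 ->
  (\int[mu]_s ((\1_`[0%R, 1%R] s)%:E * (log_kernel (quarter_arc r s - y))%:E) <=
   (- ln r)%:E + 2%:E * \int[mu]_s (invsqrt1 s)%:E)%E.
Proof.
move=> r01; have /andP[r0 r1] := r01.
have l0 : 0 <= - ln r by rewrite oppr_ge0 ln_le0.
have mI : measurable_fun setT (\1_(`[0%R, 1%R]%classic : set T) : T -> R).
  exact: measurable_indic.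
have mk := @measurable_invsqrt1 R.
have mkt : measurable_fun setT (fun s : T => invsqrt1 (s - y.2 / r)).
  by apply: (measurableT_comp mk); exact: measurable_funB.
have mL : measurable_fun setT (fun s : T => log_kernel (quarter_arc r s - y)).
  apply: (measurableT_comp measurable_log_kernel).
  have /measurable_fun_pairP[m1 m2] := measurable_quarter_arc r.
  by apply/measurable_fun_pair; apply: measurable_funB.
pose g s := ((- ln r)%:E * (\1_`[0%R, 1%R] s)%:E +
  2%:E * (invsqrt1 (s - y.2 / r))%:E)%E.
apply: (@le_trans _ _ (\int[mu]_s g s)%E).
  apply: ae_ge0_le_integral => //.
  - by move=> s _; rewrite -EFinM lee_fin mulr_ge0 ?log_kernel_ge0.
  - by apply/measurable_EFinP; exact: measurable_funM.
  - move=> s _; rewrite /g -!EFinM -EFinD lee_fin addr_ge0// mulr_ge0//.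
    exact: invsqrt1_ge0.
  - by apply/measurable_EFinP; apply: measurable_funD; apply: measurable_funM.
  (* The pointwise estimate fails at most at [s = y.2 / r]. *)
  - exists [set y.2 / r]; split => //; first exact: lebesgue_measure_set1.
    move=> s /=; apply: contra_notP => sy _; rewrite /g -!EFinM -EFinD lee_fin.
    have {}sy : s != y.2 / r by apply/eqP.
    rewrite indicE; case: (_ \in _); rewrite ?mul1r ?mulr1.
      exact: log_kernel_arc.
    by rewrite mul0r mulr0 add0r mulr_ge0// invsqrt1_ge0.
rewrite /g ge0_integralD//; last 4 first.
  - by move=> s _; rewrite -EFinM lee_fin mulr_ge0.
  - by apply/measurable_EFinP; exact: measurable_funM.
  - by move=> s _; rewrite -EFinM lee_fin mulr_ge0// invsqrt1_ge0.
  - by apply/measurable_EFinP; exact: measurable_funM.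
apply: leeD.
  rewrite ge0_integralZl_EFin//; last exact/measurable_EFinP.
  rewrite integral_indic// setIT.
  by rewrite /= lebesgue_measure_itv/= lte_fin ltr01 -EFinB subr0 mule1.
rewrite ge0_integralZl_EFin//; last 2 first.
- by move=> s _; rewrite lee_fin invsqrt1_ge0.
- exact/measurable_EFinP.
have := @ge0_integral_translation R (fun s => (invsqrt1 s)%:E) (- (y.2 / r)).
by move=> ->//; [exact/measurable_EFinP|move=> s; rewrite lee_fin invsqrt1_ge0].
Qed.

End LogKernel.

(** * Convolution of a radial density with the truncated kernel *)

Section RadialPotential.
Context {R : realType}.
Local Notation mu := (@lebesgue_measure R).
Local Notation T := (measurableTypeR R).
Variable rho : T * T -> \bar R.
Hypothesis mrho : measurable_fun setT rho.
Hypothesis rho0 : forall y, (0 <= rho y)%E.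

Let integrand_ge0 (x y : T * T) : (0 <= (log_kernel (x - y))%:E * rho y)%E.
Proof. by rewrite mule_ge0// lee_fin log_kernel_ge0. Qed.

Let measurable_integrand (x : T * T) :
  measurable_fun setT (fun y : T * T => (log_kernel (x - y))%:E * rho y)%E.
Proof.
apply: emeasurable_funM => //; apply/measurable_EFinP.
exact: measurable_log_kernel_shift.
Qed.

(** Rotating the variable of integration moves the rotation of [x] onto the
    density, which is invariant. *)
Lemma log_convolution_rotate c s x : c ^+ 2 + s ^+ 2 = 1 ->
  {ae leb2, forall y, rho (rotate c s y) = rho y} ->
  log_convolution rho (rotate c s x) = log_convolution rho x.
Proof.
move=> cs rhoR.
pose F (y : T * T) := ((log_kernel (rotate c s x - y))%:E * rho y)%E.
have mF : measurable_fun setT F by exact: measurable_integrand.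
have F0 y : (0 <= F y)%E by exact: integrand_ge0.
transitivity (\int[leb2]_y F (rotate c s y))%E.
  by symmetry; exact: (ge0_integral_rotate cs mF F0).
apply: ae_eq_integral.
- exact: measurableT.
- exact: (measurableT_comp mF (measurable_rotate c s)).
- exact: measurable_integrand.
- apply: filterS rhoR => y rhoy _.
  by rewrite /F -rotateB /log_kernel enorm_rotate// rhoy.
Qed.

Hypothesis rho_radial : forall c s, c ^+ 2 + s ^+ 2 = 1 ->
  {ae leb2, forall y, rho (rotate c s y) = rho y}.

Lemma log_convolution_arc r s : 0 <= s <= 1 ->
  log_convolution rho (quarter_arc r s) = log_convolution rho (r, 0).
Proof.
move=> /andP[s0 s1]; have h : 0 <= 1 - s ^+ 2 by rewrite subr_ge0 expr_le1.
have cs : Num.sqrt (1 - s ^+ 2) ^+ 2 + s ^+ 2 = 1 by rewrite sqr_sqrtr ?subrK.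
rewrite -(log_convolution_rotate (r, 0) cs (rho_radial cs)).
by congr log_convolution; rewrite /quarter_arc /rotate/=; congr pair; ring.
Qed.

(** The left-hand side equals its own average over the arc of radius [r]; by
    Tonelli's theorem that average is the integral of the density against the
    averaged kernel, which is bounded uniformly. *)
Lemma log_convolution_axis r : 0 < r <= 1 ->
  (log_convolution rho (r, 0%R) <=
   ((- ln r)%:E + 2%:E * \int[mu]_s (invsqrt1 s)%:E) *
   \int[leb2]_y rho y)%E.
Proof.
move=> r01.
(* The integrand, in the variables [(s, y)]. *)
pose H (p : T * (T * T)) := ((\1_`[0%R, 1%R] p.1)%:E *
  ((log_kernel (quarter_arc r p.1 - p.2))%:E * rho p.2))%E.
have mH : measurable_fun setT H.
  apply: emeasurable_funM.
    apply/measurable_EFinP; apply: (measurableT_comp _ measurable_fst).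
    exact: measurable_indic.
  apply: emeasurable_funM; last exact: (measurableT_comp mrho measurable_snd).
  apply/measurable_EFinP/(measurableT_comp measurable_log_kernel).
  have := measurableT_comp (measurable_quarter_arc r)
    (@measurable_fst _ _ T (T * T)%type).
  move=> /measurable_fun_pairP[m1 m2].
  have /measurable_fun_pairP[m3 m4] := @measurable_snd _ _ T (T * T)%type.
  apply/measurable_fun_pair.
    exact: (measurable_funB m1 m3).
  exact: (measurable_funB m2 m4).
have H0 p : (0 <= H p)%E by rewrite /H mule_ge0// lee_fin.
have -> : (log_convolution rho (r, 0%R) = \int[mu]_s \int[leb2]_y H (s, y))%E.
  transitivity (\int[mu]_s
      ((\1_`[0%R, 1%R] s)%:E * log_convolution rho (r, 0%R)))%E.
    rewrite ge0_integralZr//; last 2 first.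
    - by apply/measurable_EFinP; exact: measurable_indic.
    - by apply: integral_ge0 => y _.
    rewrite integral_indic//= setIT lebesgue_measure_itv/= lte_fin ltr01.
    by rewrite -EFinB subr0 mul1e.
  apply: eq_integral => s _; rewrite /H /= indicE.
  have [|_] := boolP (s \in _); last first.
    by rewrite mul0e integral0_eq// => y _; rewrite mul0e.
  rewrite inE/= in_itv/= => s01; rewrite mul1e -(log_convolution_arc r s01).
  by apply: eq_integral => y _; rewrite mul1e.
rewrite (@fubini_tonelli _ _ _ _ _ mu leb2 H mH H0).
rewrite -ge0_integralZl//; last first.
  rewrite adde_ge0 ?mule_ge0 ?lee_fin//.
    by case/andP: r01 => *; rewrite oppr_ge0 ln_le0.
  by apply: integral_ge0 => s _; rewrite lee_fin invsqrt1_ge0.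
have mK : measurable_fun setT (EFin \o @invsqrt1 R).
  by apply/measurable_EFinP; exact: measurable_invsqrt1.
apply: ge0_le_integral => //.
- by move=> y _; exact: integral_ge0.
- exact: (measurable_fun_fubini_tonelli_G (m1 := mu) _ mH H0).
- by apply: emeasurable_funM.
move=> y _; rewrite /H /=.
under eq_integral do rewrite muleA.
rewrite ge0_integralZr//.
- by rewrite lee_wpmul2r// integral_log_kernel_arc.
- apply/measurable_EFinP; apply: measurable_funM; first exact: measurable_indic.
  apply: (measurableT_comp measurable_log_kernel).
  have /measurable_fun_pairP[m1 m2] := measurable_quarter_arc r.
  by apply/measurable_fun_pair; apply: measurable_funB.
- by move=> s _; rewrite -EFinM lee_fin mulr_ge0// log_kernel_ge0.
Qed.

Lemma log_convolution_le x : 0 < enorm x <= 1 ->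
  (log_convolution rho x <=
   ((- ln (enorm x))%:E + 2%:E * \int[mu]_s (invsqrt1 s)%:E) *
   \int[leb2]_y rho y)%E.
Proof.
move=> x01; apply: le_trans (log_convolution_axis x01).
have x0 : enorm x != 0 by case/andP: x01 => /gt_eqF ->.
have cs : (x.1 / enorm x) ^+ 2 + (x.2 / enorm x) ^+ 2 = 1.
  by rewrite !expr_div_n -mulrDl -sqr_enorm mulfV// sqrf_eq0.
rewrite -(log_convolution_rotate (enorm x, 0) cs (rho_radial cs)).
rewrite le_eqVlt; apply/orP; left; apply/eqP; congr log_convolution.
by rewrite /rotate/= !mulr0 subr0 addr0 !divfK//; case: (x).
Qed.

End RadialPotential.

(** * Spatial densities and their potentials *)

Section Density.
Context {R : realType}.
Local Notation mu := (@lebesgue_measure R).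
Local Notation T := (measurableTypeR R).

Lemma ae_rotate c s (P : T * T -> Prop) : c ^+ 2 + s ^+ 2 = 1 ->
  {ae leb2, forall y, P y} -> {ae leb2, forall y, P (rotate c s y)}.
Proof.
move=> cs [N [mN N0 PN]].
exists (rotate c s @^-1` N); split.
- by rewrite -[X in measurable X]setTI; exact: measurable_rotate.
- have mI : measurable_fun setT (EFin \o \1_N : T * T -> \bar R).
    by apply/measurable_EFinP; exact: measurable_indic.
  have mRN : measurable (rotate c s @^-1` N).
    by rewrite -[X in measurable X]setTI; exact: measurable_rotate.
  have I0 y : (0 <= (EFin \o \1_N) y :> \bar R)%E by rewrite /= lee_fin.
  have h := ge0_integral_rotate cs mI I0.
  transitivity (\int[leb2]_y (\1_N (rotate c s y))%:E)%E.
    by have := integral_indic leb2 measurableT mRN; rewrite setIT => <-.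
  by rewrite h/= (integral_indic leb2 measurableT mN) setIT.
- by move=> y /= nP; apply: PN.
Qed.

Lemma max_oppe_mule (a : R) (r : \bar R) : (0 <= r)%E ->
  (maxe (- (a%:E * r)) 0 = (Num.max 0 (- a)%R)%:E * r)%E.
Proof.
move=> r0; rewrite -mulNe -EFinN; have [a0|a0] := leP 0 (- a).
  by rewrite max_l// mule_ge0.
by rewrite mul0e max_r// mule_le0_ge0// lee_fin ltW.
Qed.

(** The negative part of [ln |x - y| * rho' y] is the integrand of the
    convolution, and discarding the positive part bounds the potential from
    below.  The function [rho'] is an everywhere nonnegative version of the
    density. *)
Lemma log_potential_ge (rho rho' : T * T -> \bar R) (x : T * T) :
  measurable_fun setT rho -> measurable_fun setT rho' ->
  (forall y, (0 <= rho' y)%E) ->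
  {ae leb2, forall y, rho y = rho' y} ->
  (- log_convolution rho' x <= log_potential rho x)%E.
Proof.
move=> mrho mrho' rho'0 rhorho'.
have mln : measurable_fun setT
    (fun y : T * T => (ln (enorm (x - y)))%:E : \bar R).
  apply/measurable_EFinP; apply: (measurableT_comp (@measurable_ln R)).
  apply: (measurableT_comp measurable_enorm).
  by apply/measurable_fun_pair; apply: measurable_funB.
pose G (y : T * T) := ((ln (enorm (x - y)))%:E * rho' y)%E.
have mG : measurable_fun setT G by exact: emeasurable_funM.
have -> : log_potential rho x = (\int[leb2]_y G y)%E.
  apply: ae_eq_integral => //; first exact: emeasurable_funM.
  by apply: filterS rhorho' => y rhoy _; rewrite /G rhoy.
have -> : log_convolution rho' x = (\int[leb2]_y (G^\- y))%E.
  by apply: eq_integral => y _; rewrite funenegE max_oppe_mule.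
rewrite [leRHS]integralE -[leLHS]add0e; apply: leeD => //.
by apply: integral_ge0 => y _.
Qed.

Variable f : (T * T) * (T * T) -> R.
Hypothesis f1 : leb4.-integrable setT (EFin \o f).

(** For an almost everywhere nonnegative [f] this agrees almost everywhere with
    [density f], but it is nonnegative at every point, as Tonelli's theorem
    requires. *)
Definition abs_density (x : T * T) : \bar R :=
  (\int[leb2]_v `|(f (x, v))%:E|)%E.

Lemma abs_density_ge0 x : (0 <= abs_density x)%E.
Proof. exact: integral_ge0. Qed.

Let mf : measurable_fun setT (EFin \o f).
Proof. exact: measurable_int f1. Qed.

Lemma measurable_abs_density : measurable_fun setT abs_density.
Proof.
have m : measurable_fun setT (fun z => `|(f z)%:E|)%E.
  exact: measurableT_comp.
exact: (measurable_fun_fubini_tonelli_F (m2 := leb2) _ m (fun=> abse_ge0 _)).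
Qed.

Lemma integral_abs_density :
  (\int[leb2]_x abs_density x = \int[leb4]_z `|(f z)%:E|)%E.
Proof.
have m : measurable_fun setT (fun z => `|(f z)%:E|)%E.
  exact: measurableT_comp.
by rewrite /leb4 (fubini_tonelli1 _ m).
Qed.

Let pos_density (x : T * T) : \bar R := (\int[leb2]_v (EFin \o f)^\+ (x, v))%E.
Let neg_density (x : T * T) : \bar R := (\int[leb2]_v (EFin \o f)^\- (x, v))%E.

Let mpos : measurable_fun setT pos_density.
Proof.
exact: (measurable_fun_fubini_tonelli_F (m2 := leb2) _
  (measurable_funepos mf) (funepos_ge0 _)).
Qed.

Let mneg : measurable_fun setT neg_density.
Proof.
exact: (measurable_fun_fubini_tonelli_F (m2 := leb2) _
  (measurable_funeneg mf) (funeneg_ge0 _)).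
Qed.

Let densityE x : density f x = (pos_density x - neg_density x)%E.
Proof.
rewrite /density integralE; congr (_ - _)%E; apply: eq_integral => v _.
  by rewrite !funeposE.
by rewrite !funenegE.
Qed.

Let abs_densityE x : abs_density x = (pos_density x + neg_density x)%E.
Proof.
rewrite /pos_density /neg_density -ge0_integralD//.
- apply: eq_integral => v _.
  by rewrite -[RHS]/(((EFin \o f)^\+ \+ (EFin \o f)^\-)%E (x, v)) -fune_abse.
- exact: (measurableT_comp (measurable_funepos mf) (pair1_measurable x)).
- exact: (measurableT_comp (measurable_funeneg mf) (pair1_measurable x)).
Qed.

Lemma measurable_density : measurable_fun setT (density f).
Proof.
have -> : density f = (pos_density \- neg_density)%E.
  by apply/funext => x; exact: densityE.
exact: emeasurable_funB.
Qed.

(** Both are combinations of the integrals of the positive and negative parts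
    of [f], and the second one vanishes for almost every [x]. *)
Lemma density_ae_abs_density : {ae leb4, forall z, 0 <= f z} ->
  {ae leb2, forall x, density f x = abs_density x}.
Proof.
move=> f0.
have neg0 : ae_eq leb2 setT neg_density (cst 0%E).
  apply/ae_eq_integral_abs => //.
  transitivity (\int[leb4]_z (EFin \o f)^\- z)%E.
    rewrite /leb4 (fubini_tonelli1 _ (measurable_funeneg mf))//.
    apply: eq_integral => x _; rewrite gee0_abs//.
    by apply: integral_ge0 => v _.
  transitivity (\int[leb4]_z (cst 0%E : _ -> \bar R) z)%E;
    last exact: integral0.
  apply: ae_eq_integral => //; first exact: measurable_funeneg.
  apply: filterS f0 => z fz _; rewrite funenegE/=.
  by rewrite max_r// lee_fin oppr_le0.
apply: filterS neg0 => x /(_ I) neg0.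
by rewrite densityE abs_densityE neg0 sube0 adde0.
Qed.

Lemma abs_density_eq0_ae (A : set (T * T)) : measurable A ->
  {ae leb2, forall x, A x -> abs_density x = 0%E} ->
  {ae leb4, forall z, A z.1 -> f z = 0}.
Proof.
move=> mA A0.
pose H (z : (T * T) * (T * T)) := ((\1_A z.1)%:E * `|(f z)%:E|)%E.
have mabs : measurable_fun setT (fun z => `|(f z)%:E|)%E.
  exact: measurableT_comp.
have mH : measurable_fun setT H.
  apply: emeasurable_funM => //.
  apply/measurable_EFinP; apply: (measurableT_comp _ measurable_fst).
  exact: measurable_indic.
have H0 z : (0 <= H z)%E by rewrite /H mule_ge0// lee_fin.
have : ae_eq leb4 setT H (cst 0%E).
  apply/ae_eq_integral_abs => //.
  transitivity (\int[leb4]_z H z)%E.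
    by apply: eq_integral => z _; rewrite gee0_abs.
  rewrite /leb4 (fubini_tonelli1 _ mH)//.
  transitivity (\int[leb2]_x (cst 0%E : _ -> \bar R) x)%E;
    last exact: integral0.
  apply: ae_eq_integral => //.
    exact: (measurable_fun_fubini_tonelli_F (m2 := leb2) _ mH H0).
  apply: filterS A0 => x Ax _; rewrite /fubini_F /H /=.
  rewrite ge0_integralZl//; last first.
    exact: (measurableT_comp mabs (pair1_measurable x)).
  rewrite indicE; case: (boolP (x \in A)) => [|_]; last by rewrite mul0e.
  by rewrite inE => /Ax; rewrite /abs_density => ->; rewrite mule0.
apply: filterS => z /(_ I); rewrite /H indicE => Hz Az; move: Hz.
by rewrite mem_set// mul1e => /eqP; rewrite abse_eq0 => /eqP[].
Qed.

End Density.

(** * Tensor products and an integrable envelope on phase space *)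

Section Product.
Context d1 d2 (T1 : measurableType d1) (T2 : measurableType d2) (R : realType).
Variables (m1 : {sigma_finite_measure set T1 -> \bar R})
          (m2 : {sigma_finite_measure set T2 -> \bar R}).

Lemma ae_fst (P : T1 -> Prop) :
  {ae m1, forall x, P x} -> {ae (m1 \x m2)%E, forall z, P z.1}.
Proof.
move=> [N [mN N0 PN]]; exists (N `*` setT); split.
- exact: measurableX.
- have h := product_measure1E m1 m2 mN measurableT.
  apply: (etrans h); rewrite [X in (X * _)%E](N0 : m1 N = 0%E).
  by rewrite mul0e.
- by move=> z /= nP; split => //; exact: PN.
Qed.

Lemma ae_snd (P : T2 -> Prop) :
  {ae m2, forall x, P x} -> {ae (m1 \x m2)%E, forall z, P z.2}.
Proof.
move=> [N [mN N0 PN]]; exists (setT `*` N); split.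
- exact: measurableX.
- have h := product_measure1E m1 m2 measurableT mN.
  apply: (etrans h); rewrite [X in (_ * X)%E](N0 : m2 N = 0%E).
  by rewrite mule0.
- by move=> z /= nP; split => //; exact: PN.
Qed.

Lemma integral_tensor (g : T1 -> R) (h : T2 -> R) :
  measurable_fun setT g -> measurable_fun setT h ->
  (forall x, 0 <= g x) -> (forall y, 0 <= h y) ->
  (\int[m1 \x m2]_z (g z.1 * h z.2)%:E =
   \int[m1]_x (g x)%:E * \int[m2]_y (h y)%:E)%E.
Proof.
move=> mg mh g0 h0.
have m : measurable_fun setT (fun z : T1 * T2 => (g z.1 * h z.2)%:E).
  apply/measurable_EFinP; apply: measurable_funM.
    exact: (measurableT_comp mg measurable_fst).
  exact: (measurableT_comp mh measurable_snd).
have gh0 z : (0 <= (g z.1 * h z.2)%:E)%E by rewrite lee_fin mulr_ge0.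
rewrite (fubini_tonelli1 _ m gh0).
rewrite -ge0_integralZr//; last 3 first.
- exact/measurable_EFinP.
- by move=> x _; rewrite lee_fin.
- by apply: integral_ge0 => y _; rewrite lee_fin.
apply: eq_integral => x _; rewrite /fubini_F /=.
under eq_integral do rewrite EFinM.
rewrite ge0_integralZl_EFin//; last exact/measurable_EFinP.
by move=> y _; rewrite lee_fin.
Qed.

Lemma integral_tensor_lty (g : T1 -> R) (h : T2 -> R) :
  measurable_fun setT g -> measurable_fun setT h ->
  (forall x, 0 <= g x) -> (forall y, 0 <= h y) ->
  (\int[m1]_x (g x)%:E < +oo)%E -> (\int[m2]_y (h y)%:E < +oo)%E ->
  (\int[m1 \x m2]_z (g z.1 * h z.2)%:E < +oo)%E.
Proof.
move=> mg mh g0 h0 gi hi; rewrite integral_tensor//.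
by apply: lte_mul_pinfty => //; rewrite ?ge0_fin_numE//;
  apply: integral_ge0 => x _; rewrite lee_fin.
Qed.

End Product.

Section Envelope.
Context {R : realType}.
Local Notation mu := (@lebesgue_measure R).
Local Notation T := (measurableTypeR R).

(** The normalized Gaussian has integral 1. *)
Lemma integral_normal_fun_lty (s : R) : s != 0 ->
  (\int[mu]_x (normal_fun 0 s x)%:E < +oo)%E.
Proof.
move=> s0; have p0 := normal_peak_gt0 s0.
have m := @measurable_normal_fun R 0 s.
have : (\int[mu]_x (normal_pdf 0 s x)%:E =
    (normal_peak s)%:E * \int[mu]_x (normal_fun 0 s x)%:E)%E.
  rewrite normal_pdfE//; under eq_integral do rewrite EFinM.
  rewrite ge0_integralZl_EFin//.
  - by move=> x _; rewrite lee_fin normal_fun_ge0.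
  - exact/measurable_EFinP.
  - exact: ltW.
rewrite integral_normal_pdf// => h.
rewrite ltNge leye_eq; apply/eqP => hy; move: h; rewrite hy.
by rewrite gt0_muley ?lte_fin.
Qed.

(** A product of functions of one variable, so that its integrability follows
    from that of the factors. *)
Definition envelope (s : R) (z : (T * T) * (T * T)) : R :=
  (invsqrt1 z.1.1 * invsqrt1 z.1.2) *
  (normal_fun 0 s z.2.1 * normal_fun 0 s z.2.2).

Let weight1 (x : T * T) := invsqrt1 x.1 * invsqrt1 x.2.
Let weight2 s (v : T * T) := normal_fun 0 s v.1 * normal_fun 0 s v.2.

Let mw1 : measurable_fun setT weight1.
Proof.
apply: measurable_funM.
  exact: (measurableT_comp measurable_invsqrt1 measurable_fst).
exact: (measurableT_comp measurable_invsqrt1 measurable_snd).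
Qed.

Let mw2 s : measurable_fun setT (weight2 s).
Proof.
apply: measurable_funM.
  exact: (measurableT_comp (measurable_normal_fun _ _) measurable_fst).
exact: (measurableT_comp (measurable_normal_fun _ _) measurable_snd).
Qed.

Let w1_ge0 x : 0 <= weight1 x.
Proof. by rewrite mulr_ge0// invsqrt1_ge0. Qed.

Let w2_ge0 s x : 0 <= weight2 s x.
Proof. by rewrite mulr_ge0// normal_fun_ge0. Qed.

Lemma envelope_ge0 s z : 0 <= envelope s z.
Proof. exact: (mulr_ge0 (w1_ge0 z.1) (w2_ge0 s z.2)). Qed.

Lemma measurable_envelope s : measurable_fun setT (envelope s).
Proof.
apply: (measurable_funM (f := weight1 \o fst) (g := weight2 s \o snd)).
  exact: (measurableT_comp mw1 measurable_fst).
exact: (measurableT_comp (mw2 s) measurable_snd).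
Qed.

Lemma integral_envelope_lty (s : R) : s != 0 ->
  (\int[leb4]_z (envelope s z)%:E < +oo)%E.
Proof.
move=> s0.
have w1 : (\int[leb2]_x (weight1 x)%:E < +oo)%E.
  apply: (integral_tensor_lty (m1 := mu) (m2 := mu) measurable_invsqrt1
    measurable_invsqrt1 invsqrt1_ge0 invsqrt1_ge0).
    exact: integral_invsqrt1_lty.
  exact: integral_invsqrt1_lty.
have w2 : (\int[leb2]_v (weight2 s v)%:E < +oo)%E.
  apply: (integral_tensor_lty (m1 := mu) (m2 := mu)
    (measurable_normal_fun 0 s) (measurable_normal_fun 0 s)
    (normal_fun_ge0 0 s) (normal_fun_ge0 0 s)).
    exact: integral_normal_fun_lty.
  exact: integral_normal_fun_lty.
exact: (integral_tensor_lty (m1 := leb2) (m2 := leb2) mw1 (mw2 s) w1_ge0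
  (w2_ge0 s) w1 w2).
Qed.

End Envelope.

(** * The support of a steady state *)

Section SteadyState.
Context {R : realType}.
Local Notation mu := (@lebesgue_measure R).
Local Notation T := (measurableTypeR R).

(** The bound [|x|^-1 <= (|x.1| * |x.2|)^(-1/2)]. *)
Lemma inv_enorm_le_invsqrt1 (x : R * R) : x.1 != 0 -> x.2 != 0 ->
  enorm x <= 1 -> expR (- ln (enorm x)) <= invsqrt1 x.1 * invsqrt1 x.2.
Proof.
move=> x1 x2 xn.
have p1 : 0 < `|x.1| by rewrite normr_gt0.
have p2 : 0 < `|x.2| by rewrite normr_gt0.
have le1 := enorm_ge_fst x; have le2 := enorm_ge_snd x.
have r0 : 0 < enorm x by exact: lt_le_trans p1 le1.
rewrite /invsqrt1 (le_trans le1 xn) (le_trans le2 xn) /powR !normr_eq0.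
rewrite (negbTE x1) (negbTE x2) -expRD ler_expR.
have : ln `|x.1| <= ln (enorm x) by rewrite ler_ln.
have : ln `|x.2| <= ln (enorm x) by rewrite ler_ln.
lra.
Qed.

(** Write [|v|^2 / a] as [2 |v|^2 / a - |v|^2 / a] and apply the bound on
    [|v|^2] to the first term only; the second one keeps Gaussian decay in [v].
    The choice [a = 4 m + 1] makes the resulting power [|x|^(- 4 m / a)] at most
    [|x|^-1]. *)
Lemma expR_velocity_le_envelope (A m : R) (z : (R * R) * (R * R)) : 0 <= m ->
  z.1.1 != 0 -> z.1.2 != 0 -> enorm z.1 <= 1 ->
  enorm z.2 ^+ 2 / 2 <= A - m * ln (enorm z.1) ->
  expR (enorm z.2 ^+ 2 / (4 * m + 1)) <=
  expR (4 * A / (4 * m + 1)) * envelope (Num.sqrt ((4 * m + 1) / 2)) z.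
Proof.
move: z => [x v] /= m0 x1 x2 xn vA.
set a := 4 * m + 1.
have a0 : 0 < a by rewrite /a; lra.
have s2 : Num.sqrt (a / 2) ^+ 2 *+ 2 = a.
  by rewrite sqr_sqrtr ?divr_ge0 ?ltW// -mulr_natr divfK.
rewrite /envelope /normal_fun s2 !subr0 -expRD /=.
apply: (@le_trans _ _ (expR (4 * A / a) * (expR (- ln (enorm x)) *
    expR (- v.1 ^+ 2 / a + - v.2 ^+ 2 / a)))); last first.
  rewrite ler_pM2l ?expR_gt0// ler_pM2r ?expR_gt0//.
  exact: inv_enorm_le_invsqrt1.
rewrite -!expRD ler_expR.
have l0 : ln (enorm x) <= 0 by exact: ln_le0.
have -> : - v.1 ^+ 2 / a + - v.2 ^+ 2 / a = - (enorm v ^+ 2 / a).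
  by rewrite sqr_enorm; field; rewrite gt_eqF.
have : enorm v ^+ 2 / a * 2 <= 4 * (A - m * ln (enorm x)) / a.
  by rewrite mulrAC ler_pM2r ?invr_gt0//; move: vA; lra.
have : - (4 * m / a) * ln (enorm x) <= - ln (enorm x).
  rewrite mulNr lerN2 -[leLHS]mul1r ler_wnM2r//.
  by rewrite ler_pdivrMr// mul1r /a; lra.
have -> : 4 * (A - m * ln (enorm x)) / a =
    4 * A / a + - (4 * m / a) * ln (enorm x).
  by field; rewrite gt_eqF.
lra.
Qed.

Variables (phi : R -> R) (M : R) (U : R * R -> R)
  (f : (R * R) * (R * R) -> R).
Hypothesis fss : steady_state_with phi M U f.

Let f1 : leb4.-integrable setT (EFin \o f).
Proof. by apply/Lfun1_integrable; exact: ss_L1 fss. Qed.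

Let filter2 : Filter (nbhs (almost_everywhere (@leb2 R))).
Proof. exact: ae_filter_ringOfSetsType. Qed.

Let filter4 : Filter (nbhs (almost_everywhere (@leb4 R))).
Proof. exact: ae_filter_ringOfSetsType. Qed.

#[local] Existing Instance filter4.

Let mass := (\int[leb4]_z `|(f z)%:E|)%E.

Let mass_fin : mass \is a fin_num.
Proof.
rewrite ge0_fin_numE; last exact: integral_ge0.
by have /integrableP[] := f1.
Qed.

Let J := (\int[mu]_s (@invsqrt1 R s)%:E)%E.

Let J_fin : J \is a fin_num.
Proof.
rewrite ge0_fin_numE; first exact: integral_invsqrt1_lty.
by apply: integral_ge0 => s _; rewrite lee_fin invsqrt1_ge0.
Qed.

Lemma abs_density_radial c s : c ^+ 2 + s ^+ 2 = 1 ->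
  {ae leb2, forall y, abs_density f (rotate c s y) = abs_density f y}.
Proof.
move=> cs; have [r fr] := ss_radial fss.
have fa := density_ae_abs_density f1 (ss_ge0 fss).
have ar : {ae leb2, forall y, abs_density f y = r (enorm y)}.
  by apply: (@filterS2 _ _ filter2 _ _ _ _ fa fr) => y <-.
apply: (@filterS2 _ _ filter2 _ _ _ _ ar (ae_rotate cs ar)) => y -> ->.
by rewrite enorm_rotate.
Qed.

(** The negative part of the potential is controlled by the convolution with
    the truncated kernel, to which the averaging over circles applies. *)
Lemma potential_ge (x : R * R) : 0 < enorm x <= 1 ->
  - ((- ln (enorm x) + 2 * fine J) * fine mass) <= U x.
Proof.
move=> x01; have /andP[x0 x1] := x01.
have x0' : x != 0 by rewrite -enorm_eq0 gt_eqF.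
rewrite -lee_fin (ss_potential fss x0').
apply: le_trans (log_potential_ge (rho' := abs_density f) x
  (measurable_density f1) (measurable_abs_density f1)
  (abs_density_ge0 f) (density_ae_abs_density f1 (ss_ge0 fss))).
rewrite EFinN leeN2.
have := log_convolution_le (measurable_abs_density f1) (abs_density_ge0 f)
  abs_density_radial x01.
rewrite integral_abs_density//.
by rewrite -/mass -/J -(fineK mass_fin) -(fineK J_fin).
Qed.

(** A nonzero value of [f] forces the energy [|v|^2 / 2 + U x] to lie in the
    support of [phi], hence below [M]; combine this with the lower bound on [U].
    The vanishing of the density outside the unit disc gives the bound on
    [x]. *)
Lemma steady_state_support : exists A m : R, 0 <= m /\
  {ae leb4, forall z, f z != 0 ->
    [/\ z.1.1 != 0, z.1.2 != 0, enorm z.1 <= 1 &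
        enorm z.2 ^+ 2 / 2 <= A - m * ln (enorm z.1)]}.
Proof.
exists (M + 2 * fine J * fine mass), (fine mass); split.
  by rewrite fine_ge0// integral_ge0.
have ne0 : {ae mu, forall t : R, t != 0}.
  exists [set 0]; split => //; first exact: lebesgue_measure_set1.
  by move=> t /=; apply: contra_notP => /eqP.
have x10 : {ae leb4, forall z : (T * T) * (T * T), z.1.1 != 0}.
  have h : {ae leb2, forall x : T * T, x.1 != 0}.
    by have := ae_fst mu ne0.
  exact: (ae_fst leb2 h).
have x20 : {ae leb4, forall z : (T * T) * (T * T), z.1.2 != 0}.
  have h : {ae leb2, forall x : T * T, x.2 != 0}.
    by have := ae_snd mu ne0.
  exact: (ae_fst leb2 h).
have out : {ae leb4, forall z, 1 <= enorm z.1 -> f z = 0}.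
  apply: (abs_density_eq0_ae f1 (A := [set x | 1 <= enorm x])).
    rewrite -[X in measurable X]setTI.
    have := @measurable_enorm R measurableT `[1%R, +oo[%classic.
    rewrite (_ : _ @^-1` _ = [set x | 1 <= enorm x]).
      by apply; exact: measurable_itv.
    by apply/seteqP; split => x /=; rewrite in_itv/= andbT.
  have [A [_ AB fA]] := ss_compact_supp fss.
  apply: (@filterS2 _ _ filter2 _ _ _ _ 
    (density_ae_abs_density f1 (ss_ge0 fss)) fA) => x <- fx xn.
  by apply: fx => /AB/=; rewrite ltNge xn.
have form := ss_form fss.
near=> z => fz.
have z11 : z.1.1 != 0 by near: z.
have z12 : z.1.2 != 0 by near: z.
have r1 : enorm z.1 <= 1.
  rewrite leNgt; apply: contra fz => /ltW r1; apply/eqP.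
  by move: r1; near: z.
split => //.
have r0 : 0 < enorm z.1.
  by rewrite (lt_le_trans _ (enorm_ge_snd _))// normr_gt0.
have fE : f z = phi (enorm z.2 ^+ 2 / 2 + U z.1) by near: z.
have : enorm z.2 ^+ 2 / 2 + U z.1 <= M.
  by apply: (ss_phi_supp fss); apply: subset_closure; rewrite /= -fE.
have := @potential_ge z.1; rewrite r0 r1 => /(_ isT).
lra.
Unshelve. all: by end_near. Qed.

End SteadyState.

(** * Exponential moments and the theorem *)

Section LfunInfinity.
Context d (X : measurableType d) (R : realType).
Variable nu : {measure set X -> \bar R}.

Lemma Lfun_oo_bounded (h : X -> R) : h \in Lfun nu +oo%E ->
  measurable_fun setT h /\
  exists B, 0 <= B /\ {ae nu, forall z, `|h z| <= B}.
Proof.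
rewrite inE => /andP[]; rewrite !inE /= => mh; split => //; move: b.
rewrite /finite_norm unlock /Lnorm; case: ifPn => [_ hoo|].
  have [B hB] := ess_supr_bounded hoo.
  exists (Num.max 0 B); split; first by rewrite le_max lexx.
  by apply: filterS hB => z; rewrite le_max => ->; rewrite orbT.
rewrite -leNgt measure_le0 => /eqP T0 _; exists 0; split => //.
by exists setT; split.
Qed.

Lemma bounded_Lfun_oo (h : X -> R) B :
  measurable_fun setT h -> {ae nu, forall z, `|h z| <= B} ->
  h \in Lfun nu +oo%E.
Proof.
move=> mh hB; rewrite inE; apply/andP; split; rewrite inE//=.
rewrite /finite_norm unlock /Lnorm; case: ifPn => // _.
apply: (@le_lt_trans _ _ B%:E); last exact: ltry.
by apply/ess_supP.
Qed.

End LfunInfinity.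

Section Moments.
Context {R : realType}.
Local Notation T := (measurableTypeR R).

(** After taking logarithms this is [ln t <= t] for [t = 2 w^2 / (a k)]. *)
Lemma powR_le_expR_sqr (a k w : R) : 0 < a -> 0 < k -> 0 <= w ->
  w `^ k <= (a / 2 * k) `^ (k / 2) * expR (w ^+ 2 / a).
Proof.
move=> a0 k0; rewrite le_eqVlt => /predU1P[<-|w0].
  by rewrite powR0 ?gt_eqF// mulr_ge0 ?powR_ge0 ?expR_ge0.
have c0 : 0 < a / 2 * k by rewrite mulr_gt0// divr_gt0.
rewrite /powR !gt_eqF// -expRD ler_expR.
pose t := w ^+ 2 / (a / 2 * k).
have t0 : 0 < t by rewrite divr_gt0// exprn_gt0.
have lt : ln w = (ln t + ln (a / 2 * k)) / 2.
  have -> : ln t + ln (a / 2 * k) = ln w *+ 2.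
    by rewrite -lnM ?posrE// divfK ?gt_eqF// lnXn.
  by rewrite mulr2n; lra.
have -> : w ^+ 2 / a = k / 2 * t.
  by rewrite /t; field; rewrite !gt_eqF.
rewrite lt -mulrDr.
have -> : k * ((ln t + ln (a / 2 * k)) / 2) =
  k / 2 * (ln t + ln (a / 2 * k)) by field.
rewrite ler_pM2l ?divr_gt0//.
by rewrite addrC lerD2l ltW// ln_sublinear.
Qed.

(** Integrate [powR_le_expR_sqr] against [g]. *)
Lemma exponential_moment_bounds (a : R)
    (g G : (T * T) * (T * T) -> R) :
  0 < a -> measurable_fun setT g -> measurable_fun setT G ->
  (forall z, 0 <= G z) -> (\int[leb4]_z (G z)%:E < +oo)%E ->
  {ae leb4, forall z, 0 <= g z} ->
  {ae leb4, forall z, expR (enorm z.2 ^+ 2 / a) * g z <= G z} ->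
  exists C : R, 0 < C /\ forall k : R, 1 <= k ->
    (\int[leb4]_z (enorm z.2 `^ k * g z)%:E <= ((C * k) `^ (k / 2))%:E)%E.
Proof.
move=> a0 mg mG G0 Goo g0 gG.
pose I := fine (\int[leb4]_z (G z)%:E).
have IE : (\int[leb4]_z (G z)%:E = I%:E)%E.
  rewrite /I fineK// ge0_fin_numE// integral_ge0// => z _.
  by rewrite lee_fin.
pose L := Num.max 1 I; have L1 : 1 <= L by rewrite le_max lexx.
have L0 : 0 < L by exact: lt_le_trans L1.
(* With [L >= 1] and [k >= 1] the integral [I] is absorbed as
   [I <= L ^ k = (L ^+ 2) ^ (k / 2)]. *)
exists (a / 2 * L ^+ 2); split; first by rewrite mulr_gt0 ?divr_gt0// exprn_gt0.
move=> k k1; have k0 : 0 < k by exact: lt_le_trans k1.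
set c := (a / 2 * k) `^ (k / 2).
have c0 : 0 <= c by exact: powR_ge0.
have mkg : measurable_fun setT
    (fun z : (T * T) * (T * T) => enorm z.2 `^ k * g z).
  apply: measurable_funM => //.
  apply: (measurableT_comp (@measurable_powR R k)).
  exact: (measurableT_comp measurable_enorm measurable_snd).
have mEG : measurable_fun setT (EFin \o G) by apply/measurable_EFinP.
apply: (@le_trans _ _ (\int[leb4]_z (c * G z)%:E)%E).
  (* A version of the integrand that is nonnegative everywhere. *)
  pose g' z := Num.max 0 (enorm z.2 `^ k * g z).
  have mg' : measurable_fun setT g' by exact: measurable_maxr.
  have -> : (\int[leb4]_z (enorm z.2 `^ k * g z)%:E =
             \int[leb4]_z (g' z)%:E)%E.
    apply: ae_eq_integral => //; try exact/measurable_EFinP.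
    apply: filterS g0 => z gz _; congr EFin; rewrite /g' max_r//.
    by rewrite mulr_ge0 ?powR_ge0.
  apply: ae_ge0_le_integral => //; try exact/measurable_EFinP.
  - by move=> z _; rewrite lee_fin le_max lexx.
  - by move=> z _; rewrite lee_fin mulr_ge0.
  - by apply/measurable_EFinP; apply: measurable_funM.
  apply: (@filterS2 _ _ (ae_filter_ringOfSetsType leb4) _ _ _ _ g0 gG).
  move=> z gz gGz _; rewrite lee_fin /g' ge_max mulr_ge0//=.
  apply: (@le_trans _ _ (c * expR (enorm z.2 ^+ 2 / a) * g z)).
    by rewrite ler_wpM2r// powR_le_expR_sqr// enorm_ge0.
  by rewrite -mulrA ler_wpM2l.
under eq_integral do rewrite EFinM.
rewrite ge0_integralZl_EFin//; last by move=> z _; rewrite lee_fin.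
rewrite IE -EFinM lee_fin.
have -> : a / 2 * L ^+ 2 * k = a / 2 * k * L ^+ 2 by ring.
rewrite powRM ?sqr_ge0//; last by rewrite mulr_ge0 ?divr_ge0// ltW.
rewrite -/c ler_wpM2l//.
rewrite -(powR_mulrn 2 (ltW L0)) -powRrM mulrCA mulfV// mulr1.
by rewrite (le_trans _ (le1r_powR L1 k1))// le_max lexx orbT.
Qed.

End Moments.

Theorem theorem4p2 (R : realType) (f : (R * R) * (R * R) -> R)
    (hf : radial_steady_state f) (K : R) (hK : 0 < K)
    (h0 : (R * R) * (R * R) -> R) (h0_Linfty : h0 \in Lfun leb4 +oo%E)
    (h0_ge0 : {ae leb4, forall z, 0 <= h0 z}) :
  let g0 := fun z : (R * R) * (R * R) =>
    f z * \1_[set w | f w <= K] z * h0 z in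
  [/\ {ae leb4, forall z, 0 <= g0 z},
      g0 \in Lfun leb4 1 /\ g0 \in Lfun leb4 +oo%E,
      (exists m : R, 2 < m /\
        (\int[leb4]_z (enorm z.2 `^ m * g0 z)%:E < +oo)%E) &
      (exists C0 : R, 0 < C0 /\
        forall k : R, 1 <= k ->
          (\int[leb4]_z (enorm z.2 `^ k * g0 z)%:E <=
            ((C0 * k) `^ (k / 2))%:E)%E)].
Proof.
have [phi [M [U fss]]] := hf => g0.
pose F4 := ae_filter_ringOfSetsType (@leb4 R).
have [mh [B [B0 hB]]] := Lfun_oo_bounded h0_Linfty.
have /andP[] := ss_L1 fss; rewrite !inE /= => mf _.
have mg0 : measurable_fun setT g0.
  apply: measurable_funM => //; apply: measurable_funM => //.
  apply: measurable_indic; rewrite -[X in measurable X]setTI.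
  have := mf measurableT `]-oo, K]%classic (measurable_itv _).
  by rewrite (_ : _ @^-1` _ = [set w | f w <= K]).
have [A [m [m0 fA]]] := steady_state_support fss.
pose a := 4 * m + 1.
have a0 : 0 < a by rewrite /a; lra.
pose s := Num.sqrt (a / 2).
have s0 : s != 0 by rewrite gt_eqF// sqrtr_gt0 divr_gt0.
pose D := K * B * expR (4 * A / a).
have D0 : 0 <= D by rewrite !mulr_ge0 ?expR_ge0// ltW.
pose G z := D * envelope s z.
have G0 z : 0 <= G z by rewrite mulr_ge0// envelope_ge0.
have mG : measurable_fun setT G.
  by apply: measurable_funM => //; exact: measurable_envelope.
have Goo : (\int[leb4]_z (G z)%:E < +oo)%E.
  under eq_integral do rewrite EFinM.
  rewrite ge0_integralZl_EFin//.
  - by apply: lte_mul_pinfty; rewrite ?lee_fin//; exact: integral_envelope_lty.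
  - by move=> z _; rewrite lee_fin envelope_ge0.
  - by apply/measurable_EFinP; exact: measurable_envelope.
have g0_ge0 : {ae leb4, forall z, 0 <= g0 z}.
  apply: (@filterS2 _ _ F4 _ _ _ _ (ss_ge0 fss) h0_ge0) => z fz hz.
  by rewrite /g0 !mulr_ge0.
have g0_le : {ae leb4, forall z, `|g0 z| <= K * B}.
  apply: (@filterS2 _ _ F4 _ _ _ _ (ss_ge0 fss) hB) => z fz hz.
  rewrite /g0 indicE normrM ler_pM//.
  case: (boolP (z \in _)) => [|_]; last by rewrite mulr0 normr0 ltW.
  by rewrite inE/= mulr1 ger0_norm.
have g0G : {ae leb4, forall z, expR (enorm z.2 ^+ 2 / a) * g0 z <= G z}.
  apply: (@filterS2 _ _ F4 _ _ _ _ g0_le fA) => z g0z fz.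
  have [f0|f0] := eqVneq (f z) 0; first by rewrite /g0 f0 !mul0r mulr0.
  have [z1 z2 z3 z4] := fz f0.
  apply: (@le_trans _ _ (expR (enorm z.2 ^+ 2 / a) * (K * B))).
    by rewrite ler_wpM2l ?expR_ge0// (le_trans (ler_norm _)).
  rewrite /G /D [leLHS]mulrC -mulrA ler_wpM2l ?mulr_ge0 ?(ltW hK)//.
  exact: expR_velocity_le_envelope.
have [C [C0 gC]] := exponential_moment_bounds a0 mg0 mG G0 Goo g0_ge0 g0G.
split => //.
- split; last exact: (bounded_Lfun_oo (nu := leb4) mg0 g0_le).
  apply/Lfun1_integrable/integrableP; split; first exact/measurable_EFinP.
  apply: le_lt_trans Goo; apply: ae_ge0_le_integral => //.
  + by do 2 apply: measurableT_comp => //.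
  + by move=> z _; rewrite lee_fin.
  + exact/measurable_EFinP.
  apply: (@filterS2 _ _ F4 _ _ _ _ g0_ge0 g0G) => z gz gGz _.
  rewrite /= lee_fin ger0_norm// (le_trans _ gGz)// ler_peMl//.
  by rewrite -expR0 ler_expR divr_ge0 ?sqr_ge0// ltW.
- exists 3; split; first by lra.
  by apply: le_lt_trans (gC 3 _) _; [lra|exact: ltry].
- by exists C.
Qed.
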